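(* Let $G$ be a torsion free, finitely generated group which acts properly on a product $P=T_1\times\dots\times T_k$ of $k$ locally finite trees preserving factors, and suppose that $G$ does not contain a subgroup isomorphic to $\mathbb{Z}\times\mathbb{Z}$. Then for each non-identity element $g\in G$ there is an action of $G$ on some bounded valence tree $T$ which is minimal, faithful and such that $g$ acts loxodromically.
   Context: All trees are simplicial trees, regarded as metric spaces with each edge of length 1; a group acts on a tree by simplicial automorphisms, possibly inverting edges and not necessarily faithfully. A tree is locally finite if every vertex has finite valence, and has bounded valence if there is a uniform finite upper bound on the valences of its vertices. An element acts elliptically on a tree if it fixes a point (a vertex or a midpoint of an edge), and otherwise it acts loxodromically (it has an invariant axis on which it acts as a non-trivial translation). An action on a tree is minimal if there is no proper invariant subtree. A finite product $P=T_1\times\dots\times T_n$ of trees carries its natural cube complex structure. An action of $G$ on $P$ is a homomorphism from $G$ to the group of automorphisms of the cube complex $P$; it preserves factors if its image lies in $\mathrm{Aut}(T_1)\times\dots\times \mathrm{Aut}(T_n)$, and it is proper if the stabiliser in $G$ of every vertex of $P$ is a finite group. *)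

(* Defs.v *)
From mathcomp Require Import all_boot all_order all_algebra.
From mathcomp Require Import boolp classical_sets functions cardinality.

Set Implicit Arguments.
Unset Strict Implicit.
Unset Printing Implicit Defensive.

Local Open Scope classical_set_scope.
Local Open Scope card_scope.

(** * Groups *)

Section Groups.
Variable G : groupType.

Definition torsion_free : Prop :=
  forall (g : G) (n : nat), (0 < n)%N -> (g ^+ n = 1)%g -> g = 1%g.

Definition finitely_generated : Prop :=
  exists S : seq G, forall H : {pred G},
    group_closed H -> {subset S <= H} -> forall g, g \in H.

Definition has_Z2_subgroup : Prop :=
  exists2 H : {pred G}, group_closed H &
    exists f : int * int -> G,
      [/\ {morph f : x y / (x + y)%R >-> (x * y)%g},
          injective f
        & forall h, h \in H <-> exists x, f x = h].

(* A homomorphism from [G] to the group (under composition) of those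
   bijections of [X] that satisfy [aut]. *)
Definition action_by (X : Type) (aut : (X -> X) -> Prop) (rho : G -> X -> X) :
    Prop :=
  [/\ forall g, aut (rho g), rho 1%g = id
    & forall g h, rho (g * h)%g = rho g \o rho h].

End Groups.

(** * Trees *)

(* A simplicial tree, given by its vertex set and adjacency relation: a
   nonempty connected simple graph without cycles. *)
Record tree := Tree {
  vertex :> choiceType;
  adj : rel vertex;
  tree_nonempty : inhabited vertex;
  adj_sym : symmetric adj;
  adj_irrefl : irreflexive adj;
  tree_connected : forall x y, exists2 p, path adj x p & last x p = y;
  tree_acyclic : forall c, uniq c -> (2 < size c)%N -> ~~ cycle adj c
}.

Definition locally_finite (T : tree) : Prop :=
  forall x : T, finite_set [set y | adj x y].

Definition bounded_valence (T : tree) : Prop :=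
  exists N : nat, forall x : T, [set y | adj x y] #<= `I_N.

(* Inversions of edges are allowed. *)
Definition tree_aut (T : tree) (f : T -> T) : Prop :=
  bijective f /\ {mono f : x y / adj x y}.

(* The set of vertices of a subtree. It determines the subtree: a connected
   subgraph of a tree contains every edge whose endpoints it contains. *)
Definition is_subtree (T : tree) (S : set T) : Prop :=
  S !=set0 /\
  forall x y, S x -> S y ->
    exists p, [/\ path (@adj T) x p, last x p = y & forall z, z \in p -> S z].

Section TreeActions.
Variables (G : groupType) (T : tree) (rho : G -> T -> T).

Definition tree_action : Prop := action_by (@tree_aut T) rho.

Definition minimal : Prop :=
  forall S : set T, is_subtree S -> (forall g x, S x -> S (rho g x)) ->
    S = setT.

Definition faithful : Prop := injective rho.

(* [g] fixes a vertex or the midpoint of an edge; an automorphism fixing the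
   midpoint of an edge either fixes its endpoints or swaps them. *)
Definition elliptic (g : G) : Prop :=
  (exists x, rho g x = x) \/
  (exists x y, [/\ adj x y, rho g x = y & rho g y = x]).

Definition loxodromic (g : G) : Prop := ~ elliptic g.

End TreeActions.

(** * Products of trees *)

Section Products.
Variables (k : nat) (T : 'I_k -> tree).

Definition prod_vertex := forall i, T i.

Definition simplex (U : tree) (s : set U) : Prop :=
  (exists x, s = [set x]) \/ (exists x y, adj x y /\ s = [set x; y]).

(* The cubes of the product are the products of simplices of the factors.
   Cubes are represented by their sets of vertices, which determine them, so
   an automorphism of the cube complex is a bijection of the vertices that
   preserves the family of vertex sets of cubes in both directions. *)
Definition cube (C : set prod_vertex) : Prop :=
  exists s : forall i, set (T i),
    (forall i, simplex (s i)) /\ C = [set x | forall i, s i (x i)].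

Definition cube_aut (f : prod_vertex -> prod_vertex) : Prop :=
  bijective f /\ forall C, cube (f @` C) <-> cube C.

Variables (G : groupType) (rho : G -> prod_vertex -> prod_vertex).

Definition prod_action : Prop := action_by cube_aut rho.

Definition preserves_factors : Prop :=
  forall g, exists phi : forall i, T i -> T i,
    (forall i, tree_aut (phi i)) /\ rho g = fun x i => phi i (x i).

Definition proper_action : Prop :=
  forall x, finite_set [set g | rho g x = x].

End Products.

(* Main.v *)
(** Choose a minimal set [S] of factors such that [G] still acts freely on the
    vertices of the product of the factors in [S].  A non-identity [g] is
    loxodromic on some factor [T_i] with [i] in [S], as otherwise [g ^+ 2] would
    fix a vertex.  Since [G] is finitely generated, [T_i] contains an invariant
    subtree with finitely many orbits of vertices; one with the fewest orbits is
    minimal.  By minimality of [S] some [h <> 1] fixes a vertex [x] of the product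
    over [S :\ i].  If [n] acts trivially on the subtree then, by local
    finiteness, some power [h ^+ m] fixes [n x] as well, so the commutator of [n]
    and [h ^+ m] fixes both [x] and the subtree, hence is trivial; if [n <> 1],
    then [h ^+ m] and [n] generate a copy of Z x Z. *)
From HB Require Import structures.
Require Import Defs.
From mathcomp Require Import all_boot all_order all_algebra.
From mathcomp Require Import boolp classical_sets functions cardinality.
From mathcomp Require Import zify.

Set Implicit Arguments.
Unset Strict Implicit.
Unset Printing Implicit Defensive.

(** * Integer powers and copies of Z x Z *)

Section IntegerPowers.
Variable G : groupType.
Implicit Types g h : G.
Local Open Scope group_scope.

Definition zpow g (z : int) : G :=
  match z with Posz n => g ^+ n | Negz n => g ^- n.+1 end.

Lemma zpowS g (x : int) : zpow g (x + 1)%R = zpow g x * g.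
Proof.
case: x => [n|[|n]]; first by rewrite -PoszD addn1 /= expgSr.
  by rewrite /= expg1 mulVg.
have -> : (Negz n.+1 + 1)%R = Negz n by lia.
by rewrite /= [g ^+ n.+2]expgS invgM mulgVK.
Qed.

Lemma zpowD g (x y : int) : zpow g (x + y)%R = zpow g x * zpow g y.
Proof.
elim/int_ind: y => [|n IH|n IH].
- by rewrite GRing.addr0 /= expg0 mulg1.
- have -> : (x + n.+1 = x + n + 1)%R by lia.
  have -> : (n.+1 = n%:Z + 1 :> int)%R by lia.
  by rewrite zpowS zpowS IH mulgA.
- apply: (@mulIg _ g); rewrite -mulgA -zpowS -zpowS.
  have -> : (x - n.+1%:Z + 1 = x - n%:Z)%R by lia.
  by have -> : (- n.+1%:Z + 1 = - n%:Z)%R by lia.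
Qed.

Lemma zpow_eq1 g (z : int) :
  torsion_free G -> g <> 1 -> zpow g z = 1 -> z = 0%R.
Proof.
move=> tf gN1; case: z => [[|n]|n] //= gn1; case: gN1; apply: (tf _ n.+1) => //.
by apply: invg_inj; rewrite gn1 invg1.
Qed.

Lemma commute_zpow g h (a b : int) :
  commute g h -> commute (zpow g a) (zpow h b).
Proof.
move=> gh; have X m n : commute (g ^+ m) (h ^+ n) by exact: commuteX2.
case: a b => m [] n /=; [exact: X | exact/commuteV/X | |].
  exact/commute_sym/commuteV/commute_sym/X.
exact/commuteV/commute_sym/commuteV/commute_sym/X.
Qed.

(** Commutation makes [f] a homomorphism and independence makes its kernel trivial, so its image is
    the required subgroup. *)
Lemma commuting_has_Z2 g h : commute g h ->
  (forall a b, zpow g a * zpow h b = 1 -> a = 0%R /\ b = 0%R) ->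
  has_Z2_subgroup G.
Proof.
move=> gh indep; pose f (x : int * int) := zpow g x.1 * zpow h x.2.
have fD : {morph f : x y / (x + y)%R >-> x * y}.
  move=> [a b] [c d]; rewrite /f /= !zpowD -!mulgA; congr (_ * _).
  by rewrite !mulgA; congr (_ * _); exact: commute_zpow.
have f0 : f 0%R = 1 by rewrite /f /= mulg1.
have fB x y : f (x - y)%R = f x / f y.
  by apply: (@mulIg _ (f y)); rewrite -fD GRing.subrK mulgVK.
exists (fun u => `[< exists x, f x = u >]).
  split=> [|u v]; rewrite !unfold_in; first by apply/asboolP; exists 0%R.
  move=> /asboolP[x <-] /asboolP[y <-]; apply/asboolP.
  by exists (x - y)%R; rewrite fB.
exists f; split=> // [x y fxy|u]; last by rewrite unfold_in; split=> /asboolP.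
have : f (x - y)%R = 1 by rewrite fB fxy mulgV.
case: x y {fxy} => [a b] [c d] /indep[/= ac bd].
by congr (_, _); apply/GRing.subr0_eq.
Qed.

End IntegerPowers.

(** Pigeonhole principle, applied below to the translates of a vertex and to the powers of a group
    element. *)
Lemma finite_set_repeat (X : choiceType) (A : set X) (o : nat -> X) :
  finite_set A -> (forall n, A (o n)) -> exists a b, a < b /\ o a = o b.
Proof.
move=> /finite_seqP[s ->] oA.
have : ~~ uniq (map o (iota 0 (size s).+1)).
  apply/negP => /uniq_leq_size leq_s.
  have /leq_s : {subset map o (iota 0 (size s).+1) <= s}.
    by move=> _ /mapP[n _ ->]; exact: oA.
  by rewrite size_map size_iota ltnn.
case/(uniqPn (o 0)) => a [b [lt_ab]]; rewrite size_map size_iota => lt_b.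
have lt_a := ltn_trans lt_ab lt_b.
by rewrite !(nth_map 0) ?size_iota// !nth_iota// !add0n; exists a, b.
Qed.

Lemma sub_count_lt (A : eqType) (a b : pred A) (s : seq A) x :
  subpred a b -> x \in s -> ~~ a x -> b x -> count a s < count b s.
Proof.
move=> ab /splitPr[s1 s2] /negPf ax bx; rewrite !count_cat /= ax bx add0n addnCA.
by rewrite add1n ltnS leq_add ?sub_count.
Qed.

(** * Group actions on a single tree *)

Section TreeActionFacts.
Variables (G : groupType) (T : tree) (tau : G -> T -> T).
Hypothesis tau_act : tree_action tau.

Lemma act1 x : tau 1%g x = x. Proof. by case: tau_act => _ ->. Qed.

Lemma actM g h x : tau (g * h)%g x = tau g (tau h x).
Proof. by case: tau_act => _ _ ->. Qed.

Lemma actK g x : tau g^-1%g (tau g x) = x.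
Proof. by rewrite -actM mulVg act1. Qed.

Lemma actKV g x : tau g (tau g^-1%g x) = x.
Proof. by rewrite -actM mulgV act1. Qed.

Lemma act_adj g x y : adj (tau g x) (tau g y) = adj x y.
Proof. by case: tau_act => /(_ g)[_ ->]. Qed.

Lemma actV_fix g x : tau g x = x -> tau g^-1%g x = x.
Proof. by move=> gx; rewrite -{1}gx actK. Qed.

Lemma actX_fix g x n : tau g x = x -> tau (g ^+ n)%g x = x.
Proof. by move=> gx; elim: n => [|n IH]; rewrite ?act1// expgS actM IH. Qed.

Lemma act_zpow_fix g x z : tau g x = x -> tau (zpow g z) x = x.
Proof. by case: z => n gx /=; rewrite ?actV_fix// actX_fix. Qed.

(** Squaring turns an inversion of an edge into an element fixing both endpoints. *)
Lemma elliptic_sqr_fix g : elliptic tau g -> exists x, tau (g ^+ 2)%g x = x.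
Proof.
case=> [[x gx]|[x [y [_ gx gy]]]]; exists x; rewrite expg2 actM.
  by rewrite !gx.
by rewrite gx gy.
Qed.

Lemma invariant_finite_pow_fix (A : set T) h y :
  finite_set A -> (forall z, A z -> A (tau h z)) -> A y ->
  exists2 m, 0 < m & tau (h ^+ m)%g y = y.
Proof.
move=> finA hA Ay; pose o n := tau (h ^+ n)%g y.
have oA n : A (o n).
  by rewrite /o; elim: n => [|n IH]; rewrite ?act1// expgS actM; apply: hA.
have [a [b [lt_ab oab]]] := finite_set_repeat finA oA.
exists (b - a); first by rewrite subn_gt0.
rewrite -(actK (h ^+ a)%g (tau _ y)) -(actM (h ^+ a)%g) -expgnDr.
by rewrite subnKC 1?ltnW// -/(o b) -oab actK.
Qed.

(* Successively higher powers of [h] fix longer and longer initial segments of a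
   path from [x] to [y], each permuting the finite set of neighbours of the last
   fixed vertex. *)
Lemma fix_pow_fix h x y : locally_finite T -> tau h x = x ->
  exists2 m, 0 < m & tau (h ^+ m)%g y = y.
Proof.
move=> lf; have [p] := tree_connected x y.
elim: p h x => [|z p IH] h x /= => [_ <- hx|/andP[xz pz] lastz hx].
  by exists 1.
have [|m m_gt0 hmz] := @invariant_finite_pow_fix _ h z (lf x) _ xz.
  by move=> u /= xu; rewrite -hx act_adj.
have [m' m'_gt0 hmy] := IH _ _ pz lastz hmz.
by exists (m * m'); rewrite ?muln_gt0 ?m_gt0// expgnA.
Qed.

Definition invariant (X : set T) := forall g x, X x -> X (tau g x).

(** The path condition of [is_subtree]. The starting vertex itself may lie outside [X], hence the
    hypothesis [X x] in [connects_sym]. *)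
Definition connects (X : set T) x y :=
  exists p, [/\ path (@adj T) x p, last x p = y & forall z, z \in p -> X z].

Lemma connects_trans X x y z : connects X x y -> connects X y z -> connects X x z.
Proof.
move=> [p [px <- pX]] [q [qx <- qX]]; exists (p ++ q).
rewrite cat_path last_cat px; split=> // u.
by rewrite mem_cat => /orP[/pX|/qX].
Qed.

Lemma connects_adj (X : set T) x y : X y -> adj x y -> connects X x y.
Proof.
move=> Xy xy; exists [:: y]; rewrite /= xy.
by split=> // z; rewrite inE => /eqP->.
Qed.

Lemma connects_sym (X : set T) x y : X x -> connects X x y -> connects X y x.
Proof.
move=> Xx [p [+ <-]]; elim: p x Xx => [|z p IH] x Xx /=.
  by exists [::].
move=> /andP[xz pz] pX; have Xz : X z by apply: pX; rewrite inE eqxx.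
apply: (@connects_trans _ _ z).
  by apply: IH => // u up; apply: pX; rewrite inE up orbT.
by apply: connects_adj => //; rewrite adj_sym.
Qed.

Lemma connects_prefix (X : set T) x p w : path (@adj T) x p ->
  (forall z, z \in p -> X z) -> w \in p -> connects X x w.
Proof.
move=> + + wp; case/path.splitP: wp => p1 p2; rewrite cat_path => /andP[px _] pX.
exists (rcons p1 w); rewrite last_rcons; split=> // z zp.
by apply: pX; rewrite mem_cat zp.
Qed.

Lemma connects_act X g x y :
  invariant X -> connects X x y -> connects X (tau g x) (tau g y).
Proof.
move=> Xinv [p [px <- pX]]; exists (map (tau g) p); rewrite last_map; split=> //.
  by rewrite path_map; apply: sub_path px => u v /=; rewrite act_adj.
by move=> _ /mapP[z zp ->]; apply/Xinv/pX.
Qed.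

(** The list [F] may leave [X], so the same [F] serves for every smaller invariant set. *)
Definition orbits_meet (F : seq T) (X : set T) :=
  forall y, X y -> exists2 w, w \in F & exists g, y = tau g w.

(** [X] is the union of all translates of the paths from a base vertex [v] to its images under the
    generators; [F] lists the vertices of these paths. *)
Lemma cofinite_invariant_subtree : finitely_generated G ->
  exists F X, [/\ is_subtree X, invariant X & orbits_meet F X].
Proof.
case=> S genS; have [v] := tree_nonempty T.
have /choice[p pP] s : exists p, path (@adj T) v p /\ last v p = tau s v.
  by have [p] := tree_connected v (tau s v); exists p.
have pw s : path (@adj T) v (p s) by have [] := pP s.
have pl s : last v (p s) = tau s v by have [] := pP s.
pose F := v :: flatten [seq p s | s <- S].
pose X := [set y | exists2 w, w \in F & exists g, y = tau g w]%classic.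
have Xinv : invariant X.
  move=> g _ [w wF [h ->]]; exists w => //.
  by exists (g * h)%g; rewrite actM.
have FX w : w \in F -> X w by move=> wF; exists w => //; exists 1%g; rewrite act1.
have Xv : X v by apply: FX; rewrite inE eqxx.
have pX s : s \in S -> {subset p s <= F}.
  move=> sS w wp; rewrite inE; apply/orP; right; apply/flattenP.
  by exists (p s) => //; apply: map_f.
(* These elements form a subgroup containing the generators, hence all of [G]. *)
pose H : {pred G} := fun g => `[< connects X v (tau g v) >].
have HX g : connects X v (tau g v).
  suff : g \in H by move=> /asboolP.
  apply: genS g => [|s sS]; last first.
    apply/asboolP; exists (p s); split=> // z /(pX _ sS).
    exact: FX.
  split=> [|g h].
    by apply/asboolP; rewrite act1; exists [::].
  move=> /asboolP Hg /asboolP Hh; apply/asboolP; rewrite actM.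
  apply: connects_trans Hg _; apply: connects_act => //.
  (* Reversing a path from [v] to [tau h v] and moving it by the inverse of [h] joins [v] to its
     image under that inverse. *)
  by rewrite -{1}(actK h v); apply/connects_act/connects_sym.
have FvX w : w \in F -> connects X v w.
  rewrite inE => /predU1P[->|/flattenP[_ /mapP[s sS ->] wp]]; first by exists [::].
  by apply: connects_prefix wp => // z /(pX _ sS)/FX.
exists F, X; split=> //; split; first by exists v.
have vX y : X y -> connects X v y.
  move=> [w wF [g ->]]; apply: connects_trans (HX g) _.
  exact/connects_act/FvX.
by move=> x y Xx Xy; apply: connects_trans (vX _ Xy); apply/connects_sym/vX.
Qed.

(** Minimise the number of entries of [F] lying in [X]. A smaller invariant subtree misses a whole
    orbit of [X], hence an entry of [F] that [X] contains, contradicting the minimum. *)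
Lemma minimal_cofinite_subtree : finitely_generated G ->
  exists F X, [/\ is_subtree X, invariant X, orbits_meet F X &
    forall Y : set T, is_subtree Y -> invariant Y -> (Y `<=` X)%classic -> Y = X].
Proof.
move=> /cofinite_invariant_subtree[F [X0 [subX0 invX0 FX0]]].
pose good X := [/\ is_subtree X, invariant X & orbits_meet F X].
pose c (X : set T) := count (fun w => `[< X w >]) F.
have exn : exists n, `[< exists2 X, good X & c X = n >].
  by exists (c X0); apply/asboolP; exists X0.
case: (ex_minnP exn) => n /asboolP[X [subX invX FX] <-] min_c.
exists F, X; split=> // Y subY invY YX; apply/seteqP; split=> // x Xx.
have [w wF [g xE]] := FX _ Xx; rewrite xE; apply: (invY g); apply: contrapT => nYw.
have Xw : X w by rewrite -(actK g w) -xE; apply: invX.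
have: c X <= c Y.
  by apply: min_c; apply/asboolP; exists Y => //; split=> // y /YX/FX.
rewrite leqNgt => /negP; apply.
by apply: (sub_count_lt _ wF) => [u /asboolP/YX/asboolP||]; do ?exact/asboolP.
Qed.

End TreeActionFacts.

(** An existential form of nonemptiness, from which [cid] can extract a base vertex in each
    factor. *)
Lemma subtree_exists (T : tree) : exists x : T, True.
Proof. by have [x] := tree_nonempty T; exists x. Qed.

(** * Invariant subtrees as trees with their own action *)

Section Subtree.
Variables (T : tree) (X : set T) (subX : is_subtree X).

Definition subtree_vertex := {x : T | `[< X x >]}.
HB.instance Definition _ := [Choice of subtree_vertex by <:].

Definition subtree_adj : rel subtree_vertex := fun x y => adj (val x) (val y).

Lemma subtree_val (x : subtree_vertex) : X (val x).
Proof. exact/asboolP/(valP x). Qed.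

Lemma subtree_mk x : X x -> exists u : subtree_vertex, val u = x.
Proof. by move=> Xx; exists (exist _ x (asboolT Xx)). Qed.

Lemma subtree_path x p : X x -> (forall z, z \in p -> X z) ->
  exists u q, val (u : subtree_vertex) = x /\ map val (q : seq subtree_vertex) = p.
Proof.
move=> /subtree_mk[u ux] pX; exists u.
suff [q qp] : exists q : seq subtree_vertex, map val q = p by exists q.
elim: p pX => [|z p IH] pX; first by exists [::].
have [|q <-] := IH; first by move=> t tp; apply: pX; rewrite inE tp orbT.
have [|v <-] := @subtree_mk z; first by apply: pX; rewrite inE eqxx.
by exists (v :: q).
Qed.

Lemma subtree_inhabited : inhabited subtree_vertex.
Proof. by have [[x /subtree_mk[u _]] _] := subX; split. Qed.

Lemma subtree_adj_sym : symmetric subtree_adj.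
Proof. by move=> x y; apply: adj_sym. Qed.

Lemma subtree_adj_irrefl : irreflexive subtree_adj.
Proof. by move=> x; apply: adj_irrefl. Qed.

Lemma subtree_connected x y : exists2 p, path subtree_adj x p & last x p = y.
Proof.
have [p [xp px pX]] := subX.2 _ _ (subtree_val x) (subtree_val y).
have [u [q [/val_inj ux qp]]] := subtree_path (subtree_val x) pX.
exists q; first by move: xp; rewrite -qp path_map.
by apply: val_inj; rewrite -last_map qp.
Qed.

Lemma subtree_acyclic c : uniq c -> 2 < size c -> ~~ cycle subtree_adj c.
Proof.
move=> c_uniq c_size; have := @tree_acyclic T (map val c).
by rewrite map_inj_uniq ?size_map ?cycle_map; [apply | apply: val_inj].
Qed.

Definition subtree : tree :=
  Tree subtree_inhabited subtree_adj_sym subtree_adj_irrefl subtree_connected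
       subtree_acyclic.

End Subtree.

Section SubtreeAction.
Variables (G : groupType) (T : tree) (tau : G -> T -> T) (X : set T).
Hypotheses (tau_act : tree_action tau) (subX : is_subtree X)
  (invX : invariant tau X).

Definition subtree_act (g : G) (x : subtree subX) : subtree subX :=
  exist _ (tau g (val x)) (asboolT (invX g (subtree_val x))).

Lemma subtree_act_tree_action : tree_action subtree_act.
Proof.
split=> [g||g h]; last 2 first.
- by apply: funext => x; apply: val_inj; rewrite /= act1.
- by apply: funext => x; apply: val_inj; rewrite /= actM.
split; last by move=> x y; exact: (act_adj tau_act).
by exists (subtree_act g^-1%g) => x; apply: val_inj; rewrite /= ?actK ?actKV.
Qed.

Lemma subtree_act_elliptic g : elliptic subtree_act g -> elliptic tau g.
Proof.
case=> [[x /(congr1 val) gx]|[x [y [xy /(congr1 val) gx /(congr1 val) gy]]]].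
  by left; exists (val x).
by right; exists (val x), (val y).
Qed.

(** The image [Y] in [T] of an invariant subtree is again an invariant subtree, so it fills [X]. *)
Lemma subtree_act_minimal :
  (forall Y : set T, is_subtree Y -> invariant tau Y -> (Y `<=` X)%classic ->
     Y = X) ->
  minimal subtree_act.
Proof.
move=> minX S [[s0 Ss0] connS] invS; pose Y := (val @` S)%classic.
have YE : Y = X.
  apply: minX => [|g _ [x Sx <-]|_ [x Sx <-]]; last exact: subtree_val.
  - split; first by exists (val s0), s0.
    move=> _ _ [x Sx <-] [y Sy <-]; have [p [xp <- pS]] := connS _ _ Sx Sy.
    exists (map val p); rewrite path_map last_map; split=> // _ /mapP[z zp ->].
    by exists z => //; exact: pS.
  - by exists (subtree_act g x) => //; exact: invS.
apply/seteqP; split=> // x _.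
have [y Sy /val_inj <- //] : Y (val x) by rewrite YE; exact: subtree_val.
Qed.

Lemma locally_finite_bound (F : seq T) : locally_finite T ->
  exists N, forall w, w \in F -> ([set z | adj w z] #<= `I_N)%card%classic.
Proof.
move=> lf; elim: F => [|w F [N HN]]; first by exists 0.
have [n wn] := lf w; exists (maxn n N) => u; rewrite inE => /predU1P[->|/HN uN].
  by rewrite (card_le_eql wn) card_le_II leq_maxl.
by apply: (card_le_trans uN); rewrite card_le_II leq_maxr.
Qed.

(** Each vertex is a translate of some [w] in [F], and translating back embeds its neighbours into
    those of [w]; finitely many [w] give a uniform bound. *)
Lemma subtree_bounded_valence (F : seq T) :
  locally_finite T -> orbits_meet tau F X -> bounded_valence (subtree subX).
Proof.
move=> lf FX; have [N HN] := locally_finite_bound F lf; exists N => x.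
have [w wF [g xE]] := FX _ (subtree_val x).
apply: card_le_trans (HN _ wF).
suff [f] : $| {injfun [set y | adj x y]%classic >-> [set z | adj w z]%classic} |.
  exact: (inj_card_le f).
apply/injfunPex; exists (fun y => tau g^-1%g (val y)) => [y /= xy|y z _ _].
  by rewrite -(act_adj tau_act g) actKV// -xE.
by move=> /(congr1 (tau g)); rewrite !actKV// => /val_inj.
Qed.

End SubtreeAction.

(** The equivariant injection [f] lets the kernel of [sigma] be studied inside [T]. *)
Lemma minimal_restriction (G : groupType) (T : tree) (tau : G -> T -> T) :
  finitely_generated G -> locally_finite T -> tree_action tau ->
  exists (T' : tree) (sigma : G -> T' -> T'),
    [/\ tree_action sigma, bounded_valence T', minimal sigma,
        forall g, elliptic sigma g -> elliptic tau g
      & exists f : T' -> T, injective f /\ forall g x, f (sigma g x) = tau g (f x)].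
Proof.
move=> fgG lf tau_act.
have [F [X [subX invX FX minX]]] := minimal_cofinite_subtree tau_act fgG.
exists (subtree subX), (subtree_act (subX := subX) invX); split.
- exact: subtree_act_tree_action.
- exact: subtree_bounded_valence FX.
- exact: subtree_act_minimal.
- by move=> g; exact: subtree_act_elliptic.
- by exists val; split=> //; exact: val_inj.
Qed.

(** * Actions on products of trees *)

Lemma factor_actions (G : groupType) (k : nat) (T : 'I_k -> tree)
    (rho : G -> prod_vertex T -> prod_vertex T) :
  prod_action rho -> preserves_factors rho ->
  exists tau : forall i, G -> T i -> T i,
    (forall i, tree_action (tau i)) /\
    forall g x, rho g x = fun i => tau i g (x i).
Proof.
move=> [_ rho1 rhoM] /choice[phi phiP].
have rhoE g x : rho g x = fun i => phi g i (x i) by rewrite (phiP g).2.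
(* Every vertex of a factor is a coordinate of some vertex of the product, so the action laws of
   [rho] descend to each factor. *)
have x0 : prod_vertex T by move=> i; case: (cid (subtree_exists (T i))).
have lift i (v : T i) : exists x : prod_vertex T, x i = v.
  by exists (dfwith x0 v); rewrite dfwith_in.
exists (fun i g => phi g i); split=> // i; split=> [g||g h].
- exact: (phiP g).1.
- apply: funext => v; have [x <-] := lift i v.
  by rewrite -[LHS]/((fun i => phi 1%g i (x i)) i) -rhoE rho1.
- apply: funext => v; have [x <-] := lift i v; rewrite /=.
  have /(congr1 (@^~ i)) := congr1 (@^~ x) (rhoM g h).
  by rewrite /= !rhoE.
Qed.

Section FreeProduct.
Variables (G : groupType) (k : nat) (T : 'I_k -> tree).
Variable tau : forall i, G -> T i -> T i.
Hypothesis tau_act : forall i, tree_action (@tau i).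

(** Freeness on the subproduct over [S], stated with vertices of the full product whose other
    coordinates are ignored. *)
Definition free_on (S : {set 'I_k}) :=
  forall (x : prod_vertex T) g, (forall i, i \in S -> tau g (x i) = x i) -> g = 1%g.

Lemma prod_fix_pow_fix (S : {set 'I_k}) h (x y : prod_vertex T) :
  (forall i, locally_finite (T i)) ->
  (forall i, i \in S -> tau h (x i) = x i) ->
  exists2 m, 0 < m & forall i, i \in S -> tau (h ^+ m)%g (y i) = y i.
Proof.
move=> lf hx.
have /choice[m mP] i : exists m, 0 < m /\ (i \in S -> tau (h ^+ m)%g (y i) = y i).
  have [iS|] := boolP (i \in S); last by exists 1.
  by have [m ? ?] := fix_pow_fix (tau_act i) (y i) (lf i) (hx i iS); exists m.
(* The product is a multiple of every single exponent; factors outside [S] contribute an arbitrary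
   positive one. *)
exists (\prod_i m i) => [|i iS]; first by apply: prodn_gt0 => i; have [] := mP i.
by rewrite (bigD1 i)//= expgnA actX_fix// (mP i).2.
Qed.

Lemma free_on_loxodromic (S : {set 'I_k}) g : torsion_free G -> free_on S ->
  g <> 1%g -> exists2 i, i \in S & loxodromic (@tau i) g.
Proof.
move=> tf freeS gN1; apply: contrapT => nolox; apply: gN1.
have fixx i : exists x : T i, i \in S -> tau (g ^+ 2)%g x = x.
  have [x0] := tree_nonempty (T i).
  have [iS|] := boolP (i \in S); last by exists x0.
  suff /(elliptic_sqr_fix (tau_act i))[x gx] : elliptic (@tau i) g by exists x.
  by apply: contrapT => lox; apply: nolox; exists i.
apply: (tf _ 2) => //; apply: (freeS (fun i => projT1 (cid (fixx i)))) => i.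
by case: (cid (fixx i)).
Qed.

Lemma minimal_free_fix (S : {set 'I_k}) i :
  minset (fun S' : {set 'I_k} => `[< free_on S' >]) S -> i \in S ->
  exists h, h <> 1%g /\
    exists x : prod_vertex T, forall j, j \in S :\ i -> tau h (x j) = x j.
Proof.
move=> /minsetP[_ minS] iS; apply: contrapT => noh.
suff /asboolP/minS/(_ (subD1set S i)) SE : free_on (S :\ i).
  by move: iS; rewrite -SE !inE eqxx.
move=> x h hx; apply: contrapT => hN1; apply: noh; exists h; split=> //.
by exists x.
Qed.

(** The invariant subtree enters only through the orbit of its vertex [v], which [n] fixes
    pointwise. *)
Lemma fix_factor_trivial (S : {set 'I_k}) i (v : T i) h (x : prod_vertex T) n :
  torsion_free G -> (forall i, locally_finite (T i)) -> ~ has_Z2_subgroup G ->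
  free_on S -> h <> 1%g -> (forall j, j \in S :\ i -> tau h (x j) = x j) ->
  (forall g, tau n (tau g v) = tau g v) -> n = 1%g.
Proof.
move=> tf lf noZ2 freeS hN1 hx nv; apply: contrapT => nN1; apply: noZ2.
have act := tau_act; have nvv : tau n v = v by rewrite -{1}(act1 (act i) v) nv act1.
(* Replacing coordinate [i] of [x] by [v] gives a vertex on which freeness over [S] can be
   tested. *)
have free_xv c : (forall j, j \in S :\ i -> tau c (x j) = x j) -> tau c v = v ->
    c = 1%g.
  move=> cx cv; apply: (freeS (dfwith x v)) => j jS.
  have [<-|ij] := eqVneq i j; first by rewrite dfwith_in.
  by rewrite dfwith_out// cx// !inE eq_sym ij.
have [m m_gt0 hmnx] := prod_fix_pow_fix (fun j => tau n (x j)) lf hx.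
set u := (h ^+ m)%g in hmnx.
have uN1 : u <> 1%g by move=> /(tf _ _ m_gt0).
have ux j : j \in S :\ i -> tau u (x j) = x j.
  by move=> jS; rewrite actX_fix// hx.
(* Over [S :\ i], [u] fixes both [x] and its translate by [n]; in factor [i], [n] fixes both [v] and
   [tau u v]. *)
have comm1 : (u^-1 * (n^-1 * (u * n)))%g = 1%g.
  apply: free_xv => [j jS|]; rewrite !actM//.
    by rewrite hmnx// actK// actV_fix// ux.
  by rewrite nvv (actV_fix (act i) (nv u)) actK.
have un : commute u n.
  by apply: (mulgI n^-1%g); apply: (mulgI u^-1%g); rewrite comm1 mulKg mulVg.
(* In a relation, the power of [u] fixes [x] over [S :\ i] and, being inverse to a power of [n],
   also fixes [v]; so both powers are trivial. *)
apply: (commuting_has_Z2 un) => a b /mulg1_eq uanb.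
have ua1 : zpow u a = 1%g.
  apply: free_xv => [j jS|]; first by rewrite act_zpow_fix// ux.
  by rewrite -(invgK (zpow u a)) uanb actV_fix// act_zpow_fix.
split; first exact: zpow_eq1 tf uN1 ua1.
by apply: (zpow_eq1 tf nN1); rewrite -uanb ua1 invg1.
Qed.

End FreeProduct.

(** The powers of [g] lie in a finite stabiliser, so two coincide and [g] has finite order. *)
Lemma proper_free (G : groupType) (k : nat) (T : 'I_k -> tree)
    (rho : G -> prod_vertex T -> prod_vertex T) x g :
  torsion_free G -> prod_action rho -> proper_action rho -> rho g x = x ->
  g = 1%g.
Proof.
move=> tf [_ rho1 rhoM] proper gx.
have gXx n : rho (g ^+ n)%g x = x.
  by elim: n => [|n IH]; rewrite ?rho1// expgS rhoM /= IH.
have [a [b [lt_ab gab]]] := finite_set_repeat (proper x) gXx.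
apply: (tf _ (b - a)); first by rewrite subn_gt0.
by rewrite expgnFr 1?ltnW// gab mulgV.
Qed.

Theorem theorem4p4 (G : groupType) (k : nat) (T : 'I_k -> tree)
    (rho : G -> prod_vertex T -> prod_vertex T)
    (G_tf : torsion_free G) (G_fg : finitely_generated G)
    (T_lf : forall i, locally_finite (T i))
    (rho_act : prod_action rho) (rho_fact : preserves_factors rho)
    (rho_proper : proper_action rho)
    (G_noZ2 : ~ has_Z2_subgroup G) :
  forall g : G, g <> 1%g ->
    exists (T' : tree) (sigma : G -> T' -> T'),
      [/\ tree_action sigma, bounded_valence T', minimal sigma,
          faithful sigma & loxodromic sigma g].
Proof.
move=> g gN1; have [tau [tau_act rhoE]] := factor_actions rho_act rho_fact.
have free : free_on tau [set: 'I_k].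
  move=> x h hx; apply: (proper_free G_tf rho_act rho_proper (x := x)).
  by rewrite rhoE; apply: functional_extensionality_dep => i; apply: hx.
have [S minS _] := minset_exists (P := fun S => `[< free_on tau S >]) (asboolT free).
have /asboolP freeS := minsetp minS.
have [i iS lox] := free_on_loxodromic tau_act G_tf freeS gN1.
have [h [hN1 [x hx]]] := minimal_free_fix minS iS.
have [T' [sigma [sigma_act bval sigma_min ell [f [f_inj fE]]]]] :=
  minimal_restriction G_fg (T_lf i) (tau_act i).
exists T', sigma; split=> //; last by move=> /ell.
(* If [a] and [b] act alike on [T'], then [a / b] fixes the orbit of [f v] pointwise and is
   therefore trivial. *)
move=> a b ab; have [v] := tree_nonempty T'.
apply: divg1_eq.
apply: (fix_factor_trivial tau_act (v := f v) G_tf T_lf G_noZ2 freeS hN1 hx) => c.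
rewrite -!fE; congr f.
by rewrite (actM sigma_act) ab actKV.
Qed.
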